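(* Let $(\mathcal{A},\cdot)$ be a $\mathbb{K}$-superalgebra, i.e. a $\mathbb{Z}_2$-graded vector space $\mathcal{A}$ with an even bilinear map $\cdot:\mathcal{A}\times\mathcal{A}\to\mathcal{A}$. Put $as(x,y,z)=(x\cdot y)\cdot z-x\cdot(y\cdot z)$, and define bilinear operations $\{\,,\}$ and $\bullet$ on $\mathcal{A}$, on homogeneous elements, by $$\{x,y\}=\tfrac12\big(x\cdot y-(-1)^{|x||y|}y\cdot x\big),\qquad x\bullet y=\tfrac12\big(x\cdot y+(-1)^{|x||y|}y\cdot x\big).$$ Then $(\mathcal{A},\{\,,\},\bullet)$ is a Poisson superalgebra if and only if for all homogeneous $x,y,z\in\mathcal{A}$ $$3\,as(x,y,z)=(-1)^{|y||z|}(x\cdot z)\cdot y-(-1)^{|x||z|+|y||z|}(z\cdot x)\cdot y+(-1)^{|x||y|+|x||z|}(y\cdot z)\cdot x-(-1)^{|x||y|}(y\cdot x)\cdot z.$$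
   Context: $\mathbb{K}$ is a field of characteristic $0$; $|x|\in\mathbb{Z}_2$ denotes the parity of a homogeneous element $x$. A Poisson superalgebra $(\mathcal{A},\{\,,\},\bullet)$ is a $\mathbb{Z}_2$-graded vector space over $\mathbb{K}$ with two even bilinear maps $\{\,,\},\bullet:\mathcal{A}\times\mathcal{A}\to\mathcal{A}$ such that for all homogeneous $x,y,z$: (i) $(\mathcal{A},\{\,,\})$ is a Lie superalgebra: $\{x,y\}=-(-1)^{|x||y|}\{y,x\}$ and $(-1)^{|x||z|}\{x,\{y,z\}\}+(-1)^{|z||y|}\{z,\{x,y\}\}+(-1)^{|y||x|}\{y,\{z,x\}\}=0$; (ii) $(\mathcal{A},\bullet)$ is a commutative associative superalgebra: $x\bullet y=(-1)^{|x||y|}y\bullet x$ and $x\bullet(y\bullet z)=(x\bullet y)\bullet z$; (iii) $\{x,y\bullet z\}=\{x,y\}\bullet z+(-1)^{|x||y|}y\bullet\{x,z\}$. *)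

(* Defs.v *)
From HB Require Import structures.
From mathcomp Require Import all_boot all_order all_algebra.
Set Implicit Arguments.
Unset Strict Implicit.
Unset Printing Implicit Defensive.
Import GRing.Theory.
Local Open Scope ring_scope.

(* A Z_2-grading of A, i.e. a decomposition of A as the direct sum of the      *)
(* subspaces [homog G 0] and [homog G 1]. The component maps [part] are        *)
(* determined by [homog] (lemma [part_unique]), so they are no additional     *)
(* structure. Since [0] belongs to both subspaces, a statement about a         *)
(* homogeneous x of parity a quantifies over all a and x with [homog G a x].   *)
Record grading (K : fieldType) (A : lmodType K) := Grading {
  homog : 'Z_2 -> A -> Prop;
  part : 'Z_2 -> A -> A;
  homog0 : forall a, homog a 0;
  homogP : forall a (k : K) x y, homog a x -> homog a y -> homog a (k *: x + y);
  homog_part : forall a x, homog a (part a x);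
  sum_part : forall x, \sum_a part a x = x;
  part_sum : forall u : 'Z_2 -> A, (forall a, homog a (u a)) ->
    forall a, part a (\sum_b u b) = u a
}.

Section Grading.
Variables (K : fieldType) (A : lmodType K) (G : grading A).

Lemma part_unique (x : A) (u : 'Z_2 -> A) :
  (forall a, homog G a (u a)) -> \sum_a u a = x -> forall a, u a = part G a x.
Proof. by move=> hu <- a; rewrite part_sum. Qed.

Lemma part_homog a b (x : A) :
  homog G a x -> part G b x = if b == a then x else 0.
Proof.
move=> hx; apply/esym.
apply: (@part_unique x (fun c => if c == a then x else 0)).
- by move=> c; case: eqP => [->|_] //; apply: homog0.
- by rewrite -big_mkcond big_pred1_eq.
Qed.

Lemma part_linear a : linear (part G a).
Proof.
move=> k x y; apply/esym.
apply: (@part_unique _ (fun a => k *: part G a x + part G a y)).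
- by move=> b; apply: homogP; apply: homog_part.
- by rewrite big_split -scaler_sumr !sum_part.
Qed.

HB.instance Definition _ a :=
  GRing.isLinear.Build K A A *:%R (part G a) (@part_linear a).

Definition even_op (op : A -> A -> A) :=
  forall (a b : 'Z_2) (x y : A),
    homog G a x -> homog G b y -> homog G (a + b) (op x y).

Record is_lie_superalgebra (br : {bilinear A -> A -> A}) : Prop := {
  lie_even : even_op br;
  lie_skew : forall (a b : 'Z_2) (x y : A), homog G a x -> homog G b y ->
    br x y = - ((-1) ^+ (a * b)%N *: br y x);
  lie_jacobi : forall (a b c : 'Z_2) (x y z : A),
    homog G a x -> homog G b y -> homog G c z ->
    (-1) ^+ (a * c)%N *: br x (br y z) + (-1) ^+ (c * b)%N *: br z (br x y)
      + (-1) ^+ (b * a)%N *: br y (br z x) = 0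
}.

Record is_comm_assoc_superalgebra (m : {bilinear A -> A -> A}) : Prop := {
  comm_assoc_even : even_op m;
  comm_assoc_comm : forall (a b : 'Z_2) (x y : A), homog G a x -> homog G b y ->
    m x y = (-1) ^+ (a * b)%N *: m y x;
  comm_assoc_assoc : forall (a b c : 'Z_2) (x y z : A),
    homog G a x -> homog G b y -> homog G c z ->
    m x (m y z) = m (m x y) z
}.

Record is_poisson_superalgebra (br m : {bilinear A -> A -> A}) : Prop := {
  poisson_lie : is_lie_superalgebra br;
  poisson_comm_assoc : is_comm_assoc_superalgebra m;
  poisson_leibniz : forall (a b c : 'Z_2) (x y z : A),
    homog G a x -> homog G b y -> homog G c z ->
    br x (m y z) = m (br x y) z + (-1) ^+ (a * b)%N *: m y (br x z)
}.

Definition associator (mul : A -> A -> A) (x y z : A) :=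
  mul (mul x y) z - mul x (mul y z).

Variable mul : {bilinear A -> A -> A}.

(* Bilinear extensions of the formulas for homogeneous elements, which are    *)
(* recovered in [super_bracket_homog] and [super_sym_homog].                  *)
Definition super_bracket (x y : A) : A :=
  \sum_(a : 'Z_2) \sum_(b : 'Z_2)
    2%:R^-1 *: (mul (part G a x) (part G b y)
                - (-1) ^+ (a * b)%N *: mul (part G b y) (part G a x)).

Definition super_sym (x y : A) : A :=
  \sum_(a : 'Z_2) \sum_(b : 'Z_2)
    2%:R^-1 *: (mul (part G a x) (part G b y)
                + (-1) ^+ (a * b)%N *: mul (part G b y) (part G a x)).

Lemma super_bracket_bilinear :
  bilinear_for (GRing.Scale.Law.clone _ _ *:%R _)
               (GRing.Scale.Law.clone _ _ *:%R _) super_bracket.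
Proof.
split=> [y|x] k u v /=; rewrite /super_bracket scaler_sumr -big_split /=;
  apply: eq_bigr => a _; rewrite scaler_sumr -big_split /=;
  apply: eq_bigr => b _; rewrite linearP linearPl linearPr /=;
  rewrite [k *: (_ *: _)]scalerA [k * _]mulrC -scalerA -scalerDr;
  congr (_ *: _);
  by rewrite [_ ^+ _ *: (_ + _)]scalerDr opprD addrACA scalerBr !scalerA [k * _]mulrC.
Qed.

Lemma super_sym_bilinear :
  bilinear_for (GRing.Scale.Law.clone _ _ *:%R _)
               (GRing.Scale.Law.clone _ _ *:%R _) super_sym.
Proof.
split=> [y|x] k u v /=; rewrite /super_sym scaler_sumr -big_split /=;
  apply: eq_bigr => a _; rewrite scaler_sumr -big_split /=;
  apply: eq_bigr => b _; rewrite linearP linearPl linearPr /=;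
  rewrite [k *: (_ *: _)]scalerA [k * _]mulrC -scalerA -scalerDr;
  congr (_ *: _);
  by rewrite [_ ^+ _ *: (_ + _)]scalerDr addrACA scalerDr !scalerA [k * _]mulrC.
Qed.

HB.instance Definition _ := bilinear_isBilinear.Build K A A A _ _
  super_bracket super_bracket_bilinear.
HB.instance Definition _ := bilinear_isBilinear.Build K A A A _ _
  super_sym super_sym_bilinear.

Lemma super_bracket_homog a b (x y : A) : homog G a x -> homog G b y ->
  super_bracket x y = 2%:R^-1 *: (mul x y - (-1) ^+ (a * b)%N *: mul y x).
Proof.
move=> hx hy; rewrite /super_bracket (bigD1 a) //= (bigD1 b) //=.
rewrite !(part_homog _ hx) !(part_homog _ hy) !eqxx.
rewrite big1 ?addr0 => [|c /negPf cb]; last first.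
  by rewrite (part_homog _ hy) cb linear0r linear0l scaler0 subrr scaler0.
rewrite big1 ?addr0 // => c /negPf ca; rewrite big1 // => d _.
by rewrite (part_homog _ hx) ca linear0r linear0l scaler0 subrr scaler0.
Qed.

Lemma super_sym_homog a b (x y : A) : homog G a x -> homog G b y ->
  super_sym x y = 2%:R^-1 *: (mul x y + (-1) ^+ (a * b)%N *: mul y x).
Proof.
move=> hx hy; rewrite /super_sym (bigD1 a) //= (bigD1 b) //=.
rewrite !(part_homog _ hx) !(part_homog _ hy) !eqxx.
rewrite big1 ?addr0 => [|c /negPf cb]; last first.
  by rewrite (part_homog _ hy) cb linear0r linear0l scaler0 addr0 scaler0.
rewrite big1 ?addr0 // => c /negPf ca; rewrite big1 // => d _.
by rewrite (part_homog _ hx) ca linear0r linear0l scaler0 addr0 scaler0.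
Qed.

End Grading.

(* Main.v *)
(* If the identity holds, three times each x(yz) is a combination of products
   of the form (xy)z; substituting this in the Jacobi, associativity and Leibniz
   identities, expanded in terms of the product, makes all the terms cancel.
   Conversely, the product of a Poisson superalgebra is xy = {x,y} + x.y, and
   both (xy)z and x(yz) have a normal form in the six elements {x,{y,z}},
   {y,{x,z}}, x.{y,z}, y.{x,z}, z.{x,y} and x.(y.z), in which the identity can
   be checked. *)

Require Import Defs.
From mathcomp Require Import all_boot all_order all_algebra.
From mathcomp Require Import ring.
Set Implicit Arguments.
Unset Strict Implicit.
Unset Printing Implicit Defensive.
Import GRing.Theory.
Local Open Scope ring_scope.

(** * Linear combinations in a module as images of polynomials *)

(** Sending ['X^i] to the [i]-th vector is linear, so a formal identity between linear combinations
    can be checked in a commutative ring. *)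
Lemma lincomb_poly (K : fieldType) (A : lmodType K) (v : seq A) :
  exists phi : {poly K} -> A,
    [/\ phi 0 = 0, forall i, v`_i = phi 'X^i,
        forall p q, phi p + phi q = phi (p + q),
        forall p, - phi p = phi (- p) &
        forall k p, k *: phi p = phi (k%:P * p)].
Proof.
exists (fun p => \sum_(i < size v) p`_i *: v`_i); split.
- by apply: big1 => i _; rewrite coef0 scale0r.
- move=> i; have [lti | gei] := ltnP i (size v).
    rewrite (bigD1 (Ordinal lti)) //= coefXn eqxx scale1r big1 ?addr0 // => j.
    by rewrite -val_eqE coefXn /= => /negPf ->; rewrite scale0r.
  (* Past the end of [v], the default value of [nth] is 0, and ['X^i] has no coefficient in the
     range of the sum. *)
  rewrite nth_default // big1 // => j _; rewrite coefXn ltn_eqF ?scale0r //.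
  exact: leq_trans (ltn_ord j) gei.
- move=> p q; rewrite -big_split; apply: eq_bigr => i _.
  by rewrite coefD scalerDl.
- by move=> p; rewrite -sumrN; apply: eq_bigr => i _; rewrite coefN scaleNr.
- move=> k p; rewrite scaler_sumr; apply: eq_bigr => i _.
  by rewrite coefCM scalerA.
Qed.

Ltac rewrite_nth phiX i v :=
  lazymatch v with
  | nil => idtac
  | cons _ ?w =>
    let e := fresh "e" in
    have e := phiX i; rewrite /= in e; rewrite ?e; clear e;
    rewrite_nth phiX (S i) w
  end.

(* Reduces an equation between linear combinations of the vectors in v to an
   equation in {poly K}, which [ring] can solve although A is only a module. *)
Ltac to_poly v :=
  let phi := fresh "phi" in
  let phi0 := fresh "phi0" in
  let phiX := fresh "phiX" in
  let phiD := fresh "phiD" in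
  let phiN := fresh "phiN" in
  let phiZ := fresh "phiZ" in
  have [phi [phi0 phiX phiD phiN phiZ]] := lincomb_poly v;
  rewrite_nth phiX 0%N v;
  rewrite -?phi0 ?(phiD, phiN, phiZ); congr (phi _);
  clear phi phi0 phiX phiD phiN phiZ.

(** * Koszul signs *)

(** Naming the sign lets [ring] treat it as an atom whose square is 1. *)
Definition koszul (K : fieldType) (a b : 'Z_2) : K := (-1) ^+ (a * b)%N.

Lemma koszulC K a b : koszul K a b = koszul K b a.
Proof. by rewrite /koszul mulnC. Qed.

(* Stated in {poly K} to serve as a hypothesis of [ring] after [to_poly]. *)
Lemma koszul_sqr K a b : (koszul K a b)%:P * (koszul K a b)%:P = 1.
Proof. by rewrite -polyCM -expr2 sqrr_sign. Qed.

(** Addition in ['Z_2] reduces modulo 2, which is harmless because a sign depends only on the parity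
    of its exponent. *)
Lemma koszulDl K a b c : koszul K (a + b) c = koszul K a c * koszul K b c.
Proof.
rewrite /koszul -exprD -mulnDl -signr_odd -[RHS]signr_odd !oddM /=.
by rewrite modn2 oddb.
Qed.

Lemma koszulDr K a b c : koszul K a (b + c) = koszul K a b * koszul K a c.
Proof. by rewrite !(koszulC _ a) koszulDl. Qed.

(** * From a Poisson superalgebra to the identity *)

Section PoissonProduct.
Context (K : fieldType) (A : lmodType K) (G : grading A).
Context (mul br m : {bilinear A -> A -> A}).
Hypothesis P : is_poisson_superalgebra G br m.
Hypothesis mulE : forall x y, mul x y = br x y + m x y.
Local Notation kz := (koszul K).

Lemma poisson_bracketC a b x y : homog G a x -> homog G b y ->
  br x y = - (kz a b *: br y x).
Proof. exact: lie_skew (poisson_lie P) a b x y. Qed.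

Lemma poisson_mulC a b x y : homog G a x -> homog G b y ->
  m x y = kz a b *: m y x.
Proof. exact: comm_assoc_comm (poisson_comm_assoc P) a b x y. Qed.

(** The Jacobi identity solved for one term, so that two double brackets suffice in normal forms. *)
Lemma poisson_jacobi a b c x y z :
  homog G a x -> homog G b y -> homog G c z ->
  br z (br x y) = (kz a c * kz b c) *: (kz a b *: br y (br x z) - br x (br y z)).
Proof.
move=> hx hy hz; have := lie_jacobi (poisson_lie P) hx hy hz.
rewrite (poisson_bracketC hz hx) linearNr linearZr_LR /=.
rewrite -!/(koszul _ _ _) !(koszulC _ c) (koszulC _ b a) => J.
(* Subtracts [kz b c] times the Jacobi sum: the factor makes the coefficient of [br z (br x y)] in
   it a square, hence 1. *)
rewrite -[LHS]subr0 -(scaler0 _ (kz b c)) -J.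
to_poly [:: br z (br x y); br y (br x z); br x (br y z)].
ring: (koszul_sqr K a b) (koszul_sqr K b c) (koszul_sqr K a c).
Qed.

(** Of the four terms of the expansion, only [br x (m y z)] needs the Leibniz rule. *)
Lemma poisson_prod_right a b c x y z :
  homog G a x -> homog G b y -> homog G c z ->
  mul x (mul y z) = br x (br y z) + m x (br y z) + kz a b *: m y (br x z)
    + (kz a c * kz b c) *: m z (br x y) + m x (m y z).
Proof.
move=> hx hy hz; rewrite !mulE linearDr /= linearDr /=.
rewrite (poisson_leibniz P hx hy hz) -!/(koszul _ _ _).
rewrite (poisson_mulC (lie_even (poisson_lie P) hx hy) hz) koszulDl.
to_poly [:: br x (br y z); m x (br y z); m y (br x z); m z (br x y); m x (m y z)].
ring.
Qed.

Lemma poisson_prod_left a b c x y z :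
  homog G a x -> homog G b y -> homog G c z ->
  mul (mul x y) z = br x (br y z) - kz a b *: br y (br x z)
    + m x (br y z) + kz a b *: m y (br x z)
    + (kz a c * kz b c) *: m z (br x y) + m x (m y z).
Proof.
move=> hx hy hz; rewrite !mulE linearDl /= linearDl /=.
have brxy := lie_even (poisson_lie P) hx hy.
have mxy := comm_assoc_even (poisson_comm_assoc P) hx hy.
have brxz := lie_even (poisson_lie P) hx hz.
(* Both outer brackets are turned round to have [z] on the left, where Jacobi and Leibniz apply. *)
rewrite (poisson_bracketC brxy hz) (poisson_bracketC mxy hz).
rewrite (poisson_jacobi hx hy hz) (poisson_leibniz P hz hx hy).
rewrite (poisson_bracketC hz hx) (poisson_bracketC hz hy).
rewrite -!/(koszul _ _ _) linearNl linearNr linearZl_LR linearZr_LR /=.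
rewrite (poisson_mulC brxy hz) (poisson_mulC brxz hy) !koszulDl.
rewrite -(comm_assoc_assoc (poisson_comm_assoc P) hx hy hz).
rewrite !(koszulC _ c).
to_poly [:: br x (br y z); br y (br x z);
            m x (br y z); m y (br x z); m z (br x y); m x (m y z)].
ring: (koszul_sqr K a b) (koszul_sqr K b c) (koszul_sqr K a c).
Qed.

Lemma poisson_mulCA a b c x y z :
  homog G a x -> homog G b y -> homog G c z ->
  m y (m x z) = kz a b *: m x (m y z).
Proof.
move=> hx hy hz; have mA := comm_assoc_assoc (poisson_comm_assoc P).
rewrite (mA _ _ _ _ _ _ hy hx hz) (mA _ _ _ _ _ _ hx hy hz).
by rewrite (poisson_mulC hy hx) linearZl_LR koszulC.
Qed.

Lemma poisson_prod_identity a b c x y z :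
  homog G a x -> homog G b y -> homog G c z ->
  3%:R *: associator mul x y z =
    kz b c *: mul (mul x z) y - (kz a c * kz b c) *: mul (mul z x) y
    + (kz a b * kz a c) *: mul (mul y z) x - kz a b *: mul (mul y x) z.
Proof.
move=> hx hy hz; rewrite /associator.
rewrite (poisson_prod_right hx hy hz) (poisson_prod_left hx hy hz).
rewrite (poisson_prod_left hx hz hy) (poisson_prod_left hz hx hy).
rewrite (poisson_prod_left hy hz hx) (poisson_prod_left hy hx hz).
(* The normal forms of the permuted triples are brought back to the six elements for the order [x],
   [y], [z]. *)
rewrite (poisson_bracketC hz hx) (poisson_bracketC hz hy).
rewrite (poisson_bracketC hy hx).
rewrite !(linearNr, linearZr_LR) /= (poisson_jacobi hx hy hz).
rewrite (poisson_mulC hz hy) (poisson_mulC hz hx) !linearZr_LR /=.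
rewrite (poisson_mulCA hx hz hy) (poisson_mulCA hx hy hz) (poisson_mulC hz hy).
rewrite !linearZr_LR /= !(koszulC _ c) (koszulC _ b a).
to_poly [:: br x (br y z); br y (br x z);
            m x (br y z); m y (br x z); m z (br x y); m x (m y z)].
ring: (koszul_sqr K a b) (koszul_sqr K b c) (koszul_sqr K a c).
Qed.

End PoissonProduct.

(** * From the identity to a Poisson superalgebra *)

Section ProductPoisson.
Context (K : fieldType) (A : lmodType K) (G : grading A).
Context (mul : {bilinear A -> A -> A}).
Hypothesis three_neq0 : 3%:R != 0 :> K.
Hypothesis mul_even : even_op G mul.
Local Notation kz := (koszul K).
Hypothesis prod_identity : forall (a b c : 'Z_2) (x y z : A),
  homog G a x -> homog G b y -> homog G c z ->
  3%:R *: associator mul x y z =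
    kz b c *: mul (mul x z) y - (kz a c * kz b c) *: mul (mul z x) y
    + (kz a b * kz a c) *: mul (mul y z) x - kz a b *: mul (mul y x) z.

Lemma prod_right_left a b c x y z :
  homog G a x -> homog G b y -> homog G c z ->
  3%:R *: mul x (mul y z) = 3%:R *: mul (mul x y) z -
    (kz b c *: mul (mul x z) y - (kz a c * kz b c) *: mul (mul z x) y
     + (kz a b * kz a c) *: mul (mul y z) x - kz a b *: mul (mul y x) z).
Proof.
move=> hx hy hz; rewrite -(prod_identity hx hy hz) scalerBr.
by rewrite opprB addrC subrK.
Qed.

(** The bracket is the case [s = -1] and the symmetric product the case [s = 1], which allows a
    common treatment. *)
Definition twisted (s : K) (f : A -> A -> A) := forall a b x y,
  homog G a x -> homog G b y ->
  f x y = 2%:R^-1 *: (mul x y + (s * kz a b) *: mul y x).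

Lemma twisted_bracket : twisted (-1) (super_bracket G mul).
Proof.
by move=> a b x y hx hy; rewrite (super_bracket_homog _ hx hy) mulN1r scaleNr.
Qed.

Lemma twisted_sym : twisted 1 (super_sym G mul).
Proof.
by move=> a b x y hx hy; rewrite (super_sym_homog _ hx hy) mul1r.
Qed.

Lemma twisted_even s f : twisted s f -> even_op G f.
Proof.
move=> fE a b x y hx hy; rewrite (fE _ _ _ _ hx hy).
have mulyx : homog G (a + b) (mul y x) by rewrite addrC; apply: mul_even.
(* Adds a final 0 to reach the shape [k *: u + v] of [homogP]. *)
rewrite [mul x y + _]addrC -[_^-1 *: _]addr0.
exact: homogP (homogP _ mulyx (mul_even hx hy)) (homog0 G _).
Qed.

(** The factor [s * kz a b] squares to 1, so multiplying by it exchanges the two coefficients. *)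
Lemma twisted_swap s f a b x y : s * s = 1 -> twisted s f ->
  homog G a x -> homog G b y -> f x y = (s * kz a b) *: f y x.
Proof.
move=> ss fE hx hy; rewrite (fE _ _ _ _ hx hy) (fE _ _ _ _ hy hx).
rewrite (koszulC _ b a); to_poly [:: mul x y; mul y x].
have ssP : s%:P * s%:P = 1 by rewrite -polyCM ss.
ring: (koszul_sqr K a b) ssP.
Qed.

Let third : (3%:R^-1 : K)%:P * 3%:R = 1.
Proof. by rewrite -polyC_natr -polyCM mulVf. Qed.

(* The factors 3 match the left-hand side of [prod_right_left], so that the
   division by 3 occurs only in the common prefactor. *)
Lemma twisted_right s t f g a b c x y z : twisted s f -> twisted t g ->
  homog G a x -> homog G b y -> homog G c z ->
  f x (g y z) = (2%:R^-1 * 2%:R^-1 * 3%:R^-1) *: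
    (3%:R *: mul x (mul y z) + (t * kz b c) *: (3%:R *: mul x (mul z y))
     + (s * kz a b * kz a c) *: (3%:R *: mul (mul y z) x)
     + (s * t * kz a b * kz a c * kz b c) *: (3%:R *: mul (mul z y) x)).
Proof.
move=> fE gE hx hy hz; rewrite (fE _ _ _ _ hx (twisted_even gE hy hz)).
rewrite (gE _ _ _ _ hy hz) koszulDr.
rewrite !(linearZl_LR, linearZr_LR) /= !(linearDl, linearDr) /=.
rewrite !(linearZl_LR, linearZr_LR) /=.
to_poly [:: mul x (mul y z); mul x (mul z y); mul (mul y z) x; mul (mul z y) x].
ring: third.
Qed.

Lemma twisted_left s t f g a b c x y z : twisted s f -> twisted t g ->
  homog G a x -> homog G b y -> homog G c z ->
  f (g x y) z = (2%:R^-1 * 2%:R^-1 * 3%:R^-1) *: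
    (3%:R *: mul (mul x y) z + (t * kz a b) *: (3%:R *: mul (mul y x) z)
     + (s * kz a c * kz b c) *: (3%:R *: mul z (mul x y))
     + (s * t * kz a b * kz a c * kz b c) *: (3%:R *: mul z (mul y x))).
Proof.
move=> fE gE hx hy hz; rewrite (fE _ _ _ _ (twisted_even gE hx hy) hz).
rewrite (gE _ _ _ _ hx hy) koszulDl.
rewrite !(linearZl_LR, linearZr_LR) /= !(linearDl, linearDr) /=.
rewrite !(linearZl_LR, linearZr_LR) /=.
to_poly [:: mul (mul x y) z; mul (mul y x) z; mul z (mul x y); mul z (mul y x)].
ring: third.
Qed.

Lemma super_bracket_jacobi a b c x y z :
  homog G a x -> homog G b y -> homog G c z ->
  let br := super_bracket G mul in
  kz a c *: br x (br y z) + kz c b *: br z (br x y) + kz b a *: br y (br z x) = 0.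
Proof.
move=> hx hy hz br; have tw : twisted (-1) br := twisted_bracket.
rewrite (twisted_right tw tw hx hy hz) (twisted_right tw tw hz hx hy).
rewrite (twisted_right tw tw hy hz hx).
(* All six orders occur; only products of the form [mul (mul _ _) _] remain, and their coefficients
   cancel. *)
rewrite (prod_right_left hx hy hz) (prod_right_left hx hz hy).
rewrite (prod_right_left hz hx hy) (prod_right_left hz hy hx).
rewrite (prod_right_left hy hz hx) (prod_right_left hy hx hz).
rewrite !(koszulC _ c) (koszulC _ b a).
to_poly [:: mul (mul x y) z; mul (mul y x) z; mul (mul x z) y;
            mul (mul z x) y; mul (mul y z) x; mul (mul z y) x].
ring: (koszul_sqr K a b) (koszul_sqr K b c) (koszul_sqr K a c).
Qed.

Lemma super_sym_assoc a b c x y z :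
  homog G a x -> homog G b y -> homog G c z ->
  let m := super_sym G mul in m x (m y z) = m (m x y) z.
Proof.
move=> hx hy hz m; have tw : twisted 1 m := twisted_sym.
rewrite (twisted_right tw tw hx hy hz) (twisted_left tw tw hx hy hz).
rewrite (prod_right_left hx hy hz) (prod_right_left hx hz hy).
(* Four orders are enough here, as [y] is never the outer left factor. *)
rewrite (prod_right_left hz hx hy) (prod_right_left hz hy hx).
rewrite !(koszulC _ c) !(koszulC _ b a).
to_poly [:: mul (mul x y) z; mul (mul y x) z; mul (mul x z) y;
            mul (mul z x) y; mul (mul y z) x; mul (mul z y) x].
ring: (koszul_sqr K a b) (koszul_sqr K b c) (koszul_sqr K a c).
Qed.

Lemma super_leibniz a b c x y z :
  homog G a x -> homog G b y -> homog G c z ->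
  let br := super_bracket G mul in let m := super_sym G mul in
  br x (m y z) = m (br x y) z + kz a b *: m y (br x z).
Proof.
move=> hx hy hz br m; have brE : twisted (-1) br := twisted_bracket.
have mE : twisted 1 m := twisted_sym.
rewrite (twisted_right brE mE hx hy hz) (twisted_left mE brE hx hy hz).
rewrite (twisted_right mE brE hy hx hz).
rewrite (prod_right_left hx hy hz) (prod_right_left hx hz hy).
rewrite (prod_right_left hz hx hy) (prod_right_left hz hy hx).
rewrite (prod_right_left hy hz hx) (prod_right_left hy hx hz).
rewrite !(koszulC _ c) !(koszulC _ b a).
to_poly [:: mul (mul x y) z; mul (mul y x) z; mul (mul x z) y;
            mul (mul z x) y; mul (mul y z) x; mul (mul z y) x].
ring: (koszul_sqr K a b) (koszul_sqr K b c) (koszul_sqr K a c).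
Qed.

Lemma prod_identity_poisson :
  is_poisson_superalgebra G (super_bracket G mul) (super_sym G mul).
Proof.
split; last exact: super_leibniz.
- split; first exact: twisted_even twisted_bracket;
    last exact: super_bracket_jacobi.
  move=> a b x y hx hy.
  have ss : -1 * -1 = 1 :> K by rewrite mulrNN mulr1.
  by have := twisted_swap ss twisted_bracket hx hy; rewrite mulN1r scaleNr.
- split; first exact: twisted_even twisted_sym; last exact: super_sym_assoc.
  move=> a b x y hx hy.
  by have := twisted_swap (mulr1 1) twisted_sym hx hy; rewrite mul1r.
Qed.

End ProductPoisson.

(** * Recovering the product, and the equivalence *)

Lemma super_bracketDsym (K : fieldType) (A : lmodType K) (G : grading A)
    (mul : {bilinear A -> A -> A}) : 2%:R != 0 :> K -> forall x y,
  mul x y = super_bracket G mul x y + super_sym G mul x y.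
Proof.
move=> two_neq0 x y; rewrite /super_bracket /super_sym -big_split /=.
rewrite -{1}(sum_part G x) -{1}(sum_part G y) linear_sumlz /=.
apply: eq_bigr => a _; rewrite linear_sum /= -big_split; apply: eq_bigr => b _.
(* For each pair of components the signed terms cancel, leaving half of twice their product. *)
rewrite /= -scalerDr addrACA addNr addr0 -mulr2n -scaler_nat scalerA.
by rewrite mulVf ?scale1r.
Qed.

Theorem proposition2p1 (K : fieldType) (charK : [pchar K] =i pred0)
    (A : lmodType K) (G : grading A) (mul : {bilinear A -> A -> A})
    (mul_even : even_op G mul) :
  is_poisson_superalgebra G (super_bracket G mul) (super_sym G mul) <->
  (forall (a b c : 'Z_2) (x y z : A),
     homog G a x -> homog G b y -> homog G c z ->
     3%:R *: associator mul x y z =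
       (-1) ^+ (b * c)%N *: mul (mul x z) y
       - (-1) ^+ (a * c + b * c)%N *: mul (mul z x) y
       + (-1) ^+ (a * b + a * c)%N *: mul (mul y z) x
       - (-1) ^+ (a * b)%N *: mul (mul y x) z).
Proof.
(* Applied to 2 for recovering the product from its two halves, and to 3 for the converse. *)
have nat_neq0 n : n.+1%:R != 0 :> K by rewrite ((pcharf0P K).1 charK).
split=> [P a b c x y z hx hy hz | mulE].
  rewrite !exprD.
  exact: (poisson_prod_identity P (super_bracketDsym G mul _) hx hy hz).
apply: prod_identity_poisson => // a b c x y z hx hy hz.
by rewrite (mulE a b c x y z hx hy hz) !exprD.
Qed.
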